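(* Let $\Sigma$ be a topologically mixing topological Markov chain over a countable alphabet, $\widehat\mu$ an atomless Gibbs measure for a potential $\phi:\Sigma\to\mathbb R$, and $\mathcal Z$ a set with pattern $(\widetilde{\mathcal J}_j,\mathcal J_j)$. Let $\{\alpha_j\},\{\beta_j\},\{\gamma_j\},\{\delta_j\}$ be sequences of positive numbers such that for all $j\ge1$ and all $J_j\in\mathcal J_j$, $\widetilde J_j\in\widetilde{\mathcal J}_j$, $J_{j-1}\in\mathcal J_{j-1}$ with $J_j\subseteq\widetilde J_j\subset J_{j-1}$, $$e^{-\alpha_j}\le\frac{\widehat\mu(\widetilde J_j)}{\widehat\mu(J_{j-1})}\le e^{-\beta_j},\qquad e^{-\gamma_j}\le\frac{\widehat\mu(J_j)}{\widehat\mu(\widetilde J_j)},\qquad\sum_{\widetilde J_j\in\widetilde{\mathcal J}_j,\ \widetilde J_j\subset J_{j-1}}\widehat\mu(\widetilde J_j)\ge\delta_j\,\widehat\mu(J_{j-1}),$$ and $$\liminf_{j\to\infty}\frac{(\alpha_1+\cdots+\alpha_j)+(\gamma_1+\cdots+\gamma_j)}{j^{\eta}}>0\quad\text{for some }\eta>1 .$$ Then $$\mathrm{Dim}_{\widehat\mu}(\mathcal Z)\ge\liminf_{j\to\infty}\frac{(\beta_1+\cdots+\beta_j)-\log[1/(\delta_1\cdots\delta_{j+1})]}{(\alpha_1+\cdots+\alpha_j)+(\gamma_1+\cdots+\gamma_j)} .$$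
   Context: Markov chain: $\mathcal I$ alphabet, $A=(a_{i,j})$ an $\mathcal I\times\mathcal I$ matrix with entries in $\{0,1\}$, $\Sigma=\{(i_0,i_1,\dots): i_k\in\mathcal I,\ a_{i_k,i_{k+1}}=1\ \forall k\}$, metric $d((i_k),(j_k))=2^{-m}$, $m=\min\{n: i_n\ne j_n\}$, left shift $\sigma$. An $n$-cylinder is a nonempty set $C_{i_0\dots i_n}=\{k\in\Sigma: k_r=i_r,\ 0\le r\le n\}$. Topologically mixing: for all $a,b\in\mathcal I$ there is $N(a,b)$ such that for all $n\ge N(a,b)$ some $w\in\Sigma$ has $w_0=a$, $w_n=b$. Gibbs: a Borel probability $\widehat\mu$ is a Gibbs measure for $\phi$ if there are constants $P$ and $c\ge1$ with $c^{-1}\le\widehat\mu(C_{i_0\dots i_{n-1}})/\exp(-nP+\sum_{j=0}^{n-1}\phi(\sigma^jz))\le c$ for all $n\ge1$, all cylinders and all $z\in C_{i_0\dots i_{n-1}}$. Pattern set: let $\widetilde{\mathcal J}_j$ be a set of $\widetilde d_j$-cylinders and $\mathcal J_j$ a set of $d_j$-cylinders ($j\ge0$), $\widetilde{\mathcal J}_0=\mathcal J_0=\{J_0\}$, such that (i) for $j\ge1$, $d_{j-1}<\widetilde d_j\le d_j$, each element of $\mathcal J_j$ is contained in an element of $\widetilde{\mathcal J}_j$, and each element of $\widetilde{\mathcal J}_j$ is contained in an element of $\mathcal J_{j-1}$; (ii) for each $\widetilde J_j\in\widetilde{\mathcal J}_j$ there is a unique $J_j\in\mathcal J_j$ with $J_j\subseteq\widetilde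 J_j$. Then $\mathcal Z=\bigcap_{j\ge0}\bigcup_{J_j\in\mathcal J_j}J_j$ is the set with pattern $(\widetilde{\mathcal J}_j,\mathcal J_j)$. Dimension: for $E\subset\Sigma$, $M_\alpha(E)=\lim_{\varepsilon\to0}\inf\{\sum_i\widehat\mu(F_i)^\alpha: E\subset\bigcup_iF_i,\ F_i\text{ cylinders},\ \mathrm{diam}\,F_i\le\varepsilon\}$, and $\mathrm{Dim}_{\widehat\mu}(E)=\inf\{\alpha\geq 0: M_\alpha(E)=0\}$.
   Formalization: The third inequality (with δ_j) is required for every J_{j-1} in the pattern, including those containing no J̃_j; quantified only over nested triples it would be vacuous for such J_{j-1}, and the claim would fail (e.g. J_1 empty, so Z is empty and has dimension 0). *)

(* Defs.v *)
From HB Require Import structures.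
From mathcomp Require Import all_boot all_order all_algebra.
From mathcomp Require Import all_classical all_reals all_analysis.

Set Implicit Arguments.
Unset Strict Implicit.
Unset Printing Implicit Defensive.

Import Order.TTheory GRing.Theory Num.Theory.
Import numFieldNormedType.Exports.

Local Open Scope classical_set_scope.
Local Open Scope ring_scope.

(* The transition matrix is the boolean relation [A], with a_{i,j} = 1 iff
   [A i j].  The parameter [R] does not occur in the data; it fixes the field in
   which the distance takes its values, so that the metric structure below can
   be inferred from the type. *)
Record Sigma (R : realType) (I : countType) (A : rel I) : Type := MkSigma {
  letter :> nat -> I;
  letterP : forall k, A (letter k) (letter k.+1) }.

Section shift_space.
Variables (R : realType) (I : countType) (A : rel I).
Local Notation S := (Sigma R A).
Implicit Types x y z : S.

Definition left_shift (w : S) : S :=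
  MkSigma R (letter := fun k => w k.+1) (fun k => letterP w k.+1).

Definition shift_dist (x y : S) : R :=
  if pselect (exists n, x n != y n) is left h then 2 ^- ex_minn h else 0.

Lemma shift_dist_ge x y n : x n != y n -> 2 ^- n <= shift_dist x y.
Proof.
move=> xyn; rewrite /shift_dist; case: pselect => [h|[]]; last by exists n.
case: ex_minnP => m _ /(_ n xyn) mn.
by rewrite lef_pV2 ?posrE ?exprn_gt0// ler_weXn2l// ler1n.
Qed.

Lemma shift_dist_spec x y :
  (exists2 n, x n != y n & shift_dist x y = 2 ^- n) \/
  (x = y /\ shift_dist x y = 0).
Proof.
rewrite /shift_dist; case: pselect => [h|nh]; [left|right; split => //].
  by case: ex_minnP => m xym _; exists m.
have : letter x = letter y.
  apply/funext => n; apply: contrapT => xyn; apply: nh; exists n; exact/eqP.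
case: x y {nh} => [x Hx] [y Hy] /= xy; subst y.
by congr MkSigma; exact: Prop_irrelevance.
Qed.

Lemma shift_dist_ge0 x y : 0 <= shift_dist x y.
Proof.
by case: (shift_dist_spec x y) => [[n _ ->]|[_ ->]]//; rewrite invr_ge0 exprn_ge0.
Qed.

Lemma shift_distxx x : shift_dist x x = 0.
Proof. by case: (shift_dist_spec x x) => [[n /eqP]|[]]. Qed.

Lemma shift_dist_positivity x y : shift_dist x y = 0 -> x = y.
Proof.
case: (shift_dist_spec x y) => [[n _ ->]|[]//] /eqP.
by rewrite invr_eq0 expf_eq0 pnatr_eq0 andbF.
Qed.

Lemma shift_dist_sym x y : shift_dist x y = shift_dist y x.
Proof.
have le a b : shift_dist a b <= shift_dist b a.
  case: (shift_dist_spec a b) => [[n abn ->]|[_ ->]]; last exact: shift_dist_ge0.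
  by apply: shift_dist_ge; rewrite eq_sym.
by apply/eqP; rewrite eq_le !le.
Qed.

Lemma shift_dist_triangle y x z :
  shift_dist x z <= shift_dist x y + shift_dist y z.
Proof.
case: (shift_dist_spec x z) => [[n xzn ->]|[_ ->]]; last first.
  by rewrite addr_ge0 ?shift_dist_ge0.
have [xyn|xyn] := eqVneq (x n) (y n).
  rewrite xyn in xzn.
  by rewrite (le_trans (shift_dist_ge xzn))// lerDr shift_dist_ge0.
by rewrite (le_trans (shift_dist_ge xyn))// lerDl shift_dist_ge0.
Qed.

HB.instance Definition _ := gen_eqMixin S.
HB.instance Definition _ := gen_choiceMixin S.
HB.instance Definition _ := isMetric.Build R S
  shift_distxx shift_dist_positivity shift_dist_sym shift_dist_triangle.

Definition topologically_mixing :=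
  forall a b : I, exists N : nat, forall n, (N <= n)%N ->
    exists w : S, w 0%N = a /\ w n = b.

Definition is_ncylinder (n : nat) (C : set S) :=
  C !=set0 /\
  exists i : 'I_n.+1 -> I, C = [set k : S | forall r : 'I_n.+1, k r = i r].

Definition is_cylinder (C : set S) := exists n, is_ncylinder n C.

(* Only used for nonempty sets, on which the set of distances is nonempty and
   bounded by 1, so that [sup] is a genuine supremum. *)
Definition diam (F : set S) : R := sup [set mdist x y | x in F & y in F].

Record is_pattern (dt d : nat -> nat) (Jt J : nat -> set (set S)) : Prop :=
  IsPattern {
  pattern_Jt_cyl : forall j C, Jt j C -> is_ncylinder (dt j) C;
  pattern_J_cyl : forall j C, J j C -> is_ncylinder (d j) C;
  pattern_root : exists J0, Jt 0%N = [set J0] /\ J 0%N = [set J0];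
  pattern_depth : forall j, (0 < j)%N -> (d j.-1 < dt j <= d j)%N;
  pattern_J_sub : forall j, (0 < j)%N -> forall Jj, J j Jj ->
    exists2 Jtj, Jt j Jtj & Jj `<=` Jtj;
  pattern_Jt_sub : forall j, (0 < j)%N -> forall Jtj, Jt j Jtj ->
    exists2 Jp, J j.-1 Jp & Jtj `<=` Jp;
  pattern_unique : forall j Jtj, Jt j Jtj ->
    exists! Jj, J j Jj /\ Jj `<=` Jtj }.

Definition pattern_set (J : nat -> set (set S)) : set S :=
  \bigcap_j \bigcup_(C in J j) C.

(* The library's measurable types are pointed, hence the base point [x0]; a
   space carrying a probability measure is nonempty. *)
Definition pSigma (x0 : S) : Type := S.
HB.instance Definition _ (x0 : S) := Choice.on (pSigma x0).
HB.instance Definition _ (x0 : S) := isPointed.Build (pSigma x0) x0.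

Definition BorelSigma (x0 : S) :=
  g_sigma_algebraType ((@open S) : set (set (pSigma x0))).

Section measure.
Variables (x0 : S) (mu : probability (BorelSigma x0) R).

Definition is_gibbs (phi : S -> R) :=
  exists (P c : R), 1 <= c /\
    forall n, (0 < n)%N -> forall C, is_ncylinder n.-1 C -> forall z, C z ->
      c^-1 <= fine (mu C) /
              expR (- (n%:R * P) + \sum_(0 <= j < n) phi (iter j left_shift z)) <= c.

(* Covers are countable, possibly finite or empty: the index set is an arbitrary
   [D : set nat]. *)
Definition is_cylinder_cover (E : set S) (eps : R)
    (D : set nat) (F : nat -> set S) :=
  (forall i, D i -> is_cylinder (F i) /\ diam (F i) <= eps) /\
  E `<=` \bigcup_(i in D) F i.

Definition M_premeasure (alpha eps : R) (E : set S) : \bar R :=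
  ereal_inf [set (\esum_(i in c.1) (mu (c.2 i) `^ alpha))%E |
             c in [set c : set nat * (nat -> set S) |
                     is_cylinder_cover E eps c.1 c.2]].

Definition M_measure (alpha : R) (E : set S) : \bar R :=
  lim (M_premeasure alpha eps E @[eps --> 0^'+]).

Definition Dim (E : set S) : \bar R :=
  ereal_inf [set alpha%:E |
             alpha in [set alpha : R | 0 <= alpha /\ M_measure alpha E = 0%E]].

End measure.

End shift_space.

Section atomless.
Context (d : measure_display) (T : measurableType d) (R : realType).
Variable mu : set T -> \bar R.

Definition is_atom (B : set T) :=
  [/\ measurable B, (0 < mu B)%E &
      forall C, measurable C -> C `<=` B -> (mu C < mu B)%E -> mu C = 0%E].

Definition atomless := forall B, ~ is_atom B.

End atomless.

(* Main.v *)
(* Distribute a unit mass down the tree of cylinders [Jt j], each node sharing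
   its mass between its children proportionally to their measure.  A node of
   level j then has mass at most e^-(b_1+..+b_j) / (d_1..d_j), while its
   [J j]-cylinder has measure at least e^-(a_1+..+a_j+g_1+..+g_j) mu(J0).
   If s is below the lower limit, a small cylinder F meeting the pattern set
   therefore carries mass at most (mu(F)/mu(J0))^s: take the last level j with F
   inside a J_j; either F contains J_{j+1} and lies in the corresponding Jt_{j+1},
   or the mass of F is that of the Jt_{j+1}'s inside F.
   No measure on the (non-compact) shift is needed: a countable family of nodes of
   total mass less than 1 cannot cover the pattern set, since one can descend
   along nodes whose mass exceeds that of the covering nodes below them. *)

Require Import Defs.
From mathcomp Require Import all_boot all_order all_algebra.
From mathcomp Require Import all_classical all_reals all_analysis.
From mathcomp Require Import ring.

Import Order.TTheory GRing.Theory Num.Theory.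
Import numFieldNormedType.Exports.
Local Open Scope classical_set_scope.
Local Open Scope ring_scope.

(** * Sums of nonnegative terms over arbitrary index sets *)

Section esum.
Context {R : realType} {T : choiceType}.
Local Open Scope ereal_scope.

Lemma esum_pZl (I : set T) (c : R) (a : T -> \bar R) : (0 < c)%R ->
  (forall i, 0 <= a i) ->
  \esum_(i in I) (c%:E * a i) = c%:E * \esum_(i in I) a i.
Proof.
move=> c0 a0; rewrite /esum -ereal_sup_pZl// image_comp; congr ereal_sup.
by apply: eq_imagel => F _ /=; rewrite ge0_mule_fsumr.
Qed.

Lemma esum_subset (I K : set T) (a : T -> \bar R) : I `<=` K ->
  \esum_(i in I) a i <= \esum_(i in K) a i.
Proof.
move=> IK; apply: ge_ereal_sup => _ [F [finF FI] <-].
by apply: esum_ge; exists F => //; split => //; exact: subset_trans FI IK.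
Qed.

(** An [esum] is a supremum over finite subfamilies, so finite additivity and monotonicity suffice
    whatever the index set. *)
Lemma esum_disjoint_le_measure d (S : measurableType d)
    (mu : {measure set S -> \bar R}) (I : set T) (F : T -> set S) (E : set S) :
  (forall i, I i -> measurable (F i)) -> trivIset I F -> measurable E ->
  (forall i, I i -> F i `<=` E) -> \esum_(i in I) mu (F i) <= mu E.
Proof.
move=> mF tF mE FE; apply: ge_ereal_sup => _ [K [finK KI] <-].
rewrite -measure_fin_bigcup//.
- apply: le_measure; rewrite ?inE//.
    by apply: fin_bigcup_measurable => // i /KI/mF.
  by move=> x [i /KI/FE]; exact.
- exact: sub_trivIset tF.
- by move=> i /KI/mF.
Qed.

End esum.

(** * Cylinders of the shift and their nesting *)

Section cylinders.
Context {R : realType} {I : countType} {A : rel I}.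
Local Notation S := (Sigma R A).
Implicit Types (x y z : S) (C E F : set S).

(** Any point of a cylinder can serve as its defining word; nesting and equality of cylinders rest
    on this. *)
Lemma ncylinderP n C x : is_ncylinder n C -> C x ->
  forall y, C y <-> forall r, (r <= n)%N -> y r = x r.
Proof.
move=> [_ [i ->]] /= xi y; split => [yi r rn|yx r].
  have rn' : (r < n.+1)%N by [].
  by have := yi (Ordinal rn'); rewrite (xi (Ordinal rn')).
by rewrite yx ?xi// -ltnS.
Qed.

Lemma ncylinder_sub {n m C E x} : is_ncylinder n C -> is_ncylinder m E ->
  (n <= m)%N -> C x -> E x -> E `<=` C.
Proof.
move=> hC hE nm Cx Ex y /(ncylinderP _ _ _ hE Ex) yx.
by apply/(ncylinderP _ _ _ hC Cx) => r rn; apply: yx; exact: leq_trans nm.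
Qed.

Lemma ncylinder_eq {n C E x} : is_ncylinder n C -> is_ncylinder n E ->
  C x -> E x -> C = E.
Proof.
by move=> hC hE Cx Ex; apply/seteqP; split; [exact: ncylinder_sub hE hC _ Ex Cx|
  exact: ncylinder_sub hC hE _ Cx Ex].
Qed.

Lemma ncylinder_nested {n m C E x} : is_ncylinder n C -> is_ncylinder m E ->
  C x -> E x -> C `<=` E \/ E `<=` C.
Proof.
move=> hC hE Cx Ex; have [nm|/ltnW mn] := leqP n m.
  by right; exact: ncylinder_sub hC hE nm Cx Ex.
by left; exact: ncylinder_sub hE hC mn Ex Cx.
Qed.

Lemma ncylinder_open n C : is_ncylinder n C -> open C.
Proof.
move=> hC; rewrite openE => x Cx; rewrite /interior -nbhs_ballE.
exists (2 ^- n) => /=; first by rewrite invr_gt0 exprn_gt0.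
move=> y xy; apply/(ncylinderP _ _ _ hC Cx) => r rn.
apply/eqP/negP => /negP; rewrite eq_sym => /(@shift_dist_ge R) xyr.
move: xy; rewrite -metricType_numDomainType.ball_mdistE /=.
apply/negP; rewrite -leNgt; apply: le_trans xyr.
by rewrite lef_pV2 ?posrE ?exprn_gt0// ler_weXn2l// ler1n.
Qed.

Lemma ncylinder_measurable (x0 : S) n C : is_ncylinder n C ->
  measurable (C : set (BorelSigma x0)).
Proof. by move=> /ncylinder_open oC; exact: sub_sigma_algebra. Qed.

Lemma shift_dist_le1 x y : shift_dist x y <= 1.
Proof.
case: (shift_dist_spec x y) => [[n _ ->]|[_ ->]//].
by rewrite invf_le1 ?exprn_gt0// exprn_ege1// ler1n.
Qed.

Lemma diam_agree F n : diam F < 2 ^- n ->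
  forall x y, F x -> F y -> forall r, (r <= n)%N -> y r = x r.
Proof.
move=> Fn x y Fx Fy r rn; apply/eqP/negP => /negP.
rewrite eq_sym => /(@shift_dist_ge R) xyr.
have : 2 ^- n <= diam F :> R.
  apply: (@le_trans _ _ (shift_dist x y)).
    apply: le_trans xyr.
    by rewrite lef_pV2 ?posrE ?exprn_gt0// ler_weXn2l// ler1n.
  apply: ub_le_sup.
    by exists 1 => _ [u _ [v _ <-]]; exact: shift_dist_le1.
  by exists x => //; exists y.
by rewrite leNgt Fn.
Qed.

End cylinders.

(** * Positivity of cylinders and absence of atoms *)

Section gibbs.
Context {R : realType} {I : countType} {A : rel I}.
Local Notation S := (Sigma R A).
Context {x0 : S} {mu : probability (BorelSigma x0) R} {phi : S -> R}.

Lemma gibbs_cylinder_gt0 n (C : set S) : is_gibbs mu phi -> is_ncylinder n C ->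
  0 < fine (mu C).
Proof.
move=> [P [c [c1 gib]]] hC; have [z Cz] := hC.1.
have /andP[+ _] := gib n.+1 isT C hC z Cz; set e := expR _.
rewrite ler_pdivlMr ?expR_gt0//; apply: lt_le_trans.
by rewrite mulr_gt0 ?expR_gt0// invr_gt0 (lt_le_trans _ c1).
Qed.

(** A one-point cylinder would be an atom: it has positive measure and no proper nonempty subset. *)
Lemma gibbs_cylinder_two n (C : set S) : is_gibbs mu phi -> atomless mu ->
  is_ncylinder n C -> exists x y, [/\ C x, C y & x <> y].
Proof.
move=> gib atl hC; apply: contrapT => Csub.
have mC := @ncylinder_measurable _ _ _ x0 _ _ hC.
apply: (atl C); split => //.
  rewrite -[mu C]fineK ?fin_num_measure// lte_fin.
  exact: gibbs_cylinder_gt0 gib hC.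
move=> E mE EC EltC; have [->|/set0P[x Ex]] := eqVneq E set0; first by rewrite measure0.
suff EC' : E = C by rewrite EC' ltxx in EltC.
apply/seteqP; split=> // y Cy; apply: contrapT => nEy; apply: Csub.
by exists x, y; split=> //; [exact: EC|move=> xy; rewrite -xy in nEy].
Qed.

End gibbs.

(** * The tree of pattern cylinders *)

Section pattern.
Context {R : realType} {I : countType} {A : rel I}.
Local Notation S := (Sigma R A).
Context {dt d : nat -> nat} {Jt J : nat -> set (set S)}.
Hypothesis pat : is_pattern dt d Jt J.
Implicit Types (j : nat) (C D E : set S).

(** Well defined on [Jt j] by uniqueness in the pattern; the default [set0] is never taken there. *)
Definition core (J : nat -> set (set S)) j D : set S :=
  xget set0 [set E | J j E /\ E `<=` D].

Definition children (Jt J : nat -> set (set S)) j D : set (set S) :=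
  [set C | Jt j.+1 C /\ C `<=` core J j D].

Lemma coreP j D : Jt j D -> J j (core J j D) /\ core J j D `<=` D.
Proof.
move=> /(pattern_unique pat)[E [JE _]].
by apply: (@xgetPex _ set0 [set E | J j E /\ E `<=` D]); exists E.
Qed.

Lemma core_eq j D E : Jt j D -> J j E -> E `<=` D -> core J j D = E.
Proof.
move=> JtD JE ED; have [E' [_ uE']] := pattern_unique pat JtD.
by rewrite -(uE' _ (coreP _ _ JtD)) (uE' E).
Qed.

Lemma Jt_eq j C D x : Jt j C -> Jt j D -> C x -> D x -> C = D.
Proof.
move=> /(pattern_Jt_cyl pat)hC /(pattern_Jt_cyl pat)hD.
exact: ncylinder_eq hC hD.
Qed.

Lemma Jt_trivIset j : trivIset (Jt j) id.
Proof. by move=> C D JC JD [x [Cx Dx]]; exact: Jt_eq JC JD Cx Dx. Qed.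

Lemma Jt_neq0 j C : Jt j C -> C !=set0.
Proof. by move=> /(pattern_Jt_cyl pat)[]. Qed.

(** Lets the tree be indexed by [Jt] alone. The inclusions of a pattern start at level 1, so level 0
    uses the common root. *)
Lemma J_core j E : J j E -> exists2 D, Jt j D & E = core J j D.
Proof.
case: j => [|j] JE; last first.
  have [D JtD ED] := pattern_J_sub pat (ltn0Sn j) JE.
  by exists D => //; rewrite (core_eq _ _ _ JtD JE ED).
have [J0 [JtE0 JE0]] := pattern_root pat.
move: (JE); rewrite JE0 => EJ0.
have JtE : Jt 0%N E by rewrite JtE0.
by exists E => //; rewrite (core_eq _ _ _ JtE JE).
Qed.

Lemma Jt_parent j C : Jt j.+1 C -> exists2 D, Jt j D & children Jt J j D C.
Proof.
move=> JtC; have [E JE CE] := pattern_Jt_sub pat (ltn0Sn j) JtC.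
by have [D JtD ED] := J_core _ _ JE; exists D => //; rewrite /children /= -ED.
Qed.

Lemma children_sub j D C : Jt j D -> children Jt J j D C -> C `<=` D.
Proof. by move=> /coreP[_ cD] [_ CD]; exact: subset_trans cD. Qed.

Lemma children_inj j D D' C : Jt j D -> Jt j D' ->
  children Jt J j D C -> children Jt J j D' C -> D = D'.
Proof.
move=> JD JD' hD hD'; have [x Cx] := Jt_neq0 _ _ hD.1.
exact: Jt_eq JD JD' (children_sub _ _ _ JD hD _ Cx) (children_sub _ _ _ JD' hD' _ Cx).
Qed.

Lemma depth_ge j : (j <= d j)%N /\ (j <= dt j)%N.
Proof.
elim: j => // j [IH _].
have /andP[+ +] := pattern_depth pat (isT : (0 < j.+1)%N).
by move=> /= dlt tle; split; [apply: leq_trans tle|]; apply: leq_ltn_trans dlt.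
Qed.

Lemma mem_patternP z : pattern_set J z ->
  forall j, exists2 D, Jt j D & core J j D z.
Proof.
move=> Zz j; have [E JE Ez] := Zz j Logic.I.
by have [D JD ED] := J_core _ _ JE; exists D => //; rewrite -ED.
Qed.

(** Depths grow strictly, so every letter of the limit point is fixed from some level on; this
    stands in for compactness. *)
Lemma path_point (f : nat -> set S) :
  (forall j, Jt j (f j)) -> (forall j, children Jt J j (f j) (f j.+1)) ->
  exists2 z, pattern_set J z & forall j, f j z.
Proof.
move=> Jf chf; have fS j k : (j <= k)%N -> f k `<=` f j.
  elim: k => [|k IH]; first by rewrite leqn0 => /eqP ->.
  rewrite leq_eqVlt => /predU1P[->//|/IH]; apply: subset_trans.
  exact: children_sub (Jf k) (chf k).
have [p fp] : {p : nat -> S & forall j, f j (p j)}.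
  by apply: choice => j; exact: Jt_neq0 (Jf j).
have agree j k n : (j <= k)%N -> (n <= dt j)%N -> p k n = p j n.
  move=> jk nj.
  have := (ncylinderP _ _ _ (pattern_Jt_cyl pat (Jf j)) (fp j) (p k)).1
    (fS _ _ jk _ (fp k)).
  exact.
(* Both letters of the diagonal word can be read off [p n.+2], where the transition is allowed. *)
have Az n : A (p n.+1 n) (p n.+2 n.+1).
  rewrite -(agree n.+1 n.+2 n)//; first exact: letterP.
  by apply: leq_trans (depth_ge n.+1).2.
pose z : S := MkSigma R (letter := fun n => p n.+1 n) Az.
have fz j : f j z.
  apply/(ncylinderP _ _ _ (pattern_Jt_cyl pat (Jf j)) (fp j)) => n nj /=.
  have [jn|nj'] := leqP j n.+1; first exact: agree.
  by rewrite (agree n.+1 j) ?(ltnW nj')// (leq_trans _ (depth_ge n.+1).2).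
exists z => // j _; exists (core J j (f j)); first exact: (coreP _ _ (Jf j)).1.
exact: (chf j).2 _ (fz j.+1).
Qed.

(** * Descent along cheaply covered nodes *)

Section descent.
Context {nu : nat -> set S -> R} (nu0 : forall j C, 0 <= nu j C).
Hypothesis nu_sub : forall j D, Jt j D ->
  ((nu j D)%:E <= \esum_(C in children Jt J j D) (nu j.+1 C)%:E)%E.
Context {X : choiceType} {L : set X} {lev : X -> nat} {node : X -> set S}.
Hypothesis JtL : forall x, L x -> Jt (lev x) (node x).

Let cost j D := (\esum_(x in [set x | [/\ L x, (j <= lev x)%N & node x `<=` D]])
  (nu (lev x) (node x))%:E)%E.

(** If every child cost at least its mass, so would [D], since a covering node lies in at most one
    child. *)
Let cost_step j D : Jt j D -> (cost j D < (nu j D)%:E)%E ->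
  exists2 C, children Jt J j D C & (cost j.+1 C < (nu j.+1 C)%:E)%E.
Proof.
move=> JD; apply: contraPP => /forall2NP noC; apply/negP; rewrite -leNgt.
apply: (le_trans (nu_sub _ _ JD)).
apply: (@le_trans _ _ (\esum_(C in children Jt J j D) cost j.+1 C)%E).
  by apply: le_esum => C hC; have [//|/negP] := noC C; rewrite leNgt.
rewrite esum_esum; last by move=> *; rewrite lee_fin.
rewrite -(@esum_image _ _ _ _ snd (fun x => (nu (lev x) (node x))%:E)).
  apply: esum_subset => _ [[C x] [/= hC [Lx jx xC]] <-].
  split=> //; first exact: ltnW.
  exact: subset_trans (children_sub _ _ _ JD hC).
move=> [C x] [C' x'] /=; rewrite !inE => -[/= hC [Lx _ xC]] [/= hC' [_ _ xC']] xx'.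
rewrite -xx' in xC' *; have [y xy] := Jt_neq0 _ _ (JtL _ Lx).
by rewrite (Jt_eq _ _ _ _ hC.1 hC'.1 (xC _ xy) (xC' _ xy)).
Qed.

(* If the cover is too cheap, some path of the tree has cheap cover at every
   node; its limit point avoids the cover. *)
Lemma cover_cost_ge J0 : Jt 0%N J0 ->
  pattern_set J `<=` \bigcup_(x in L) node x ->
  ((nu 0%N J0)%:E <= \esum_(x in L) (nu (lev x) (node x))%:E)%E.
Proof.
move=> JJ0 cov; rewrite leNgt; apply/negP => cheap.
pose good (p : nat * set S) := Jt p.1 p.2 /\ (cost p.1 p.2 < (nu p.1 p.2)%:E)%E.
pose next (p q : {p | good p}) :=
  (sval q).1 = (sval p).1.+1 /\ children Jt J (sval p).1 (sval p).2 (sval q).2.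
have good0 : good (0%N, J0).
  by split=> //=; apply: le_lt_trans cheap; apply: esum_subset => x [].
have nextP (p : {p | good p}) : {q | next p q}.
  apply: cid; case: p => -[j D] gD; have [/= JD cD] := gD.
  have [C hC cC] := cost_step _ _ JD cD.
  by exists (exist _ (j.+1, C) (conj hC.1 cC)).
have [g [g0 gn]] := dependent_choice nextP (exist _ _ good0).
have lg n : (sval (g n)).1 = n by elim: n => [|n IH]; rewrite ?g0// (gn n).1 IH.
pose f n := (sval (g n)).2.
have Jf n : Jt n (f n) by have [+ _] := svalP (g n); rewrite lg.
have cf n : (cost n (f n) < (nu n (f n))%:E)%E.
  by have [_] := svalP (g n); rewrite lg.
have chf n : children Jt J n (f n) (f n.+1) by have [_] := gn n; rewrite lg.
have [z Zz fz] := path_point _ Jf chf.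
have [x Lx xz] := cov _ Zz.
(* The covering node through [z] is the path's node at its level, so its own mass is part of the
   cost there: the path is not cheap. *)
have xf : node x = f (lev x) := Jt_eq _ _ _ _ (JtL _ Lx) (Jf _) xz (fz _).
have := cf (lev x); rewrite -xf ltNge => /negP; apply.
rewrite -[leLHS](@esum_set1 _ _ x (fun x => (nu (lev x) (node x))%:E)) ?lee_fin//.
by apply: esum_subset => _ ->; split.
Qed.

End descent.
End pattern.

(** * Measure of nodes, cores and children *)

Section mass.
Context {R : realType} {I : countType} {A : rel I}.
Local Notation S := (Sigma R A).
Context {x0 : S} {mu : probability (BorelSigma x0) R} {phi : S -> R}.
Context {dt d : nat -> nat} {Jt J : nat -> set (set S)}.
Context {alpha beta gamma delta : nat -> R}.
Hypothesis gib : is_gibbs mu phi.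
Hypothesis atl : atomless mu.
Hypothesis pat : is_pattern dt d Jt J.
Hypothesis pos : forall j, (0 < j)%N ->
  [/\ 0 < alpha j, 0 < beta j, 0 < gamma j & 0 < delta j].
Hypothesis ratio : forall j, (0 < j)%N -> forall Jj Jtj Jp : set S,
  J j Jj -> Jt j Jtj -> J j.-1 Jp -> Jj `<=` Jtj -> Jtj `<=` Jp ->
  expR (- alpha j) <= fine (mu Jtj) / fine (mu Jp) <= expR (- beta j) /\
  expR (- gamma j) <= fine (mu Jj) / fine (mu Jtj).
Hypothesis dens : forall j, (0 < j)%N -> forall Jp : set S, J j.-1 Jp ->
  ((delta j)%:E * mu Jp <= \esum_(C in [set C | Jt j C /\ C `<=` Jp]) mu C)%E.
Implicit Types (j : nat) (C D E F : set S).

Let m C := fine (mu C).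
Local Notation cr := (core J).
Local Notation ch := (children Jt J).

Let cyl_fineK n C : is_ncylinder n C -> mu C = (m C)%:E.
Proof.
by move=> hC; rewrite fineK// fin_num_measure//; exact: ncylinder_measurable hC.
Qed.

Let m_le n k C E : is_ncylinder n C -> is_ncylinder k E -> C `<=` E -> m C <= m E.
Proof.
move=> hC hE CE; rewrite -lee_fin -(cyl_fineK _ _ hC) -(cyl_fineK _ _ hE).
by apply: le_measure; rewrite ?inE//; [exact: ncylinder_measurable hC|
  exact: ncylinder_measurable hE].
Qed.

Let core_cyl j D : Jt j D -> is_ncylinder (d j) (cr j D).
Proof. by move=> /(coreP pat)[/(pattern_J_cyl pat)]. Qed.

Let core_gt0 j D : Jt j D -> 0 < m (cr j D).
Proof. by move=> JD; exact: gibbs_cylinder_gt0 gib (core_cyl _ _ JD). Qed.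

Let Jt_gt0 j D : Jt j D -> 0 < m D.
Proof. by move=> JD; exact: gibbs_cylinder_gt0 gib (pattern_Jt_cyl pat JD). Qed.

Let sub_mass n F j (K : set (set S)) : is_ncylinder n F -> K `<=` Jt j ->
  (forall C, K C -> C `<=` F) -> (\esum_(C in K) mu C <= (m F)%:E)%E.
Proof.
move=> hF KJ KF; rewrite -(cyl_fineK _ _ hF).
apply: (@esum_disjoint_le_measure _ _ _ _ mu _ id) => //.
- by move=> C /KJ /(pattern_Jt_cyl pat); exact: ncylinder_measurable.
- exact: sub_trivIset (Jt_trivIset pat j).
- exact: ncylinder_measurable hF.
Qed.

Definition children_mass (mu : set S -> \bar R) (Jt J : nat -> set (set S)) j D : R :=
  fine (\esum_(C in children Jt J j D) mu C).
Local Notation cm := (children_mass mu Jt J).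

Let cmE j D : Jt j D -> (\esum_(C in ch j D) mu C = (cm j D)%:E)%E.
Proof.
move=> JD; rewrite /children_mass fineK// ge0_fin_numE; last exact: esum_ge0.
apply: (@le_lt_trans _ _ (m (cr j D))%:E); last exact: ltry.
by apply: (sub_mass _ _ j.+1 _ (core_cyl _ _ JD)) => C [].
Qed.

(** Below: the density hypothesis. Above: children are disjoint subsets of the core. *)
Let cm_bounds j D : Jt j D -> delta j.+1 * m (cr j D) <= cm j D <= m (cr j D).
Proof.
move=> JD; have [Jc _] := coreP pat _ _ JD.
rewrite -!lee_fin -cmE// EFinM -(cyl_fineK _ _ (core_cyl _ _ JD)) (dens j.+1)//=.
rewrite (cyl_fineK _ _ (core_cyl _ _ JD)).
by apply: (sub_mass _ _ j.+1 _ (core_cyl _ _ JD)) => C [].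
Qed.

Let cm_gt0 j D : Jt j D -> 0 < cm j D.
Proof.
move=> JD; have /andP[+ _] := cm_bounds _ _ JD; apply: lt_le_trans.
by have [_ _ _ d0] := pos j.+1 isT; rewrite mulr_gt0// core_gt0.
Qed.

Let delta_le1 j D : Jt j D -> delta j.+1 <= 1.
Proof.
move=> JD; have /andP[lo hi] := cm_bounds _ _ JD.
by rewrite -(ler_pM2r (core_gt0 _ _ JD)) mul1r (le_trans lo hi).
Qed.

Let has_child j D : Jt j D -> exists C, ch j D C.
Proof.
move=> JD; have [ch0|/set0P//] := eqVneq (ch j D) set0.
by have := cm_gt0 _ _ JD; rewrite /children_mass ch0 esum_set0 /= ltxx.
Qed.

(** Inequalities between the sequences alone are read off a node, so one is needed at each level. *)
Let Jt_inhabited j : exists D, Jt j D.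
Proof.
elim: j => [|j [D JD]].
  by have [J0 [JE _]] := pattern_root pat; exists J0; rewrite JE.
by have [C [JC _]] := has_child _ _ JD; exists C.
Qed.

Let child_ratio j D C : Jt j D -> ch j D C ->
  [/\ expR (- alpha j.+1) * m (cr j D) <= m C,
      m C <= expR (- beta j.+1) * m (cr j D) &
      expR (- gamma j.+1) * m C <= m (cr j.+1 C)].
Proof.
move=> JD [JC CD]; have [Jc _] := coreP pat _ _ JD.
have [Jc' cC] := coreP pat _ _ JC.
have [] := ratio j.+1 isT _ _ _ Jc' JC Jc cC CD.
by rewrite ler_pdivlMr ?core_gt0// ler_pdivrMr ?core_gt0//
  ler_pdivlMr ?(Jt_gt0 _ _ JC)//
  => /andP[].
Qed.

(** * The mass distribution on the tree *)

Definition parent (Jt J : nat -> set (set S)) j C : set S :=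
  xget set0 [set D | Jt j D /\ children Jt J j D C].

(** Off the tree [parent] takes its default and the value is meaningless, but it stays nonnegative,
    as the descent asks for all sets. *)
Fixpoint weight (mu : set S -> \bar R) (Jt J : nat -> set (set S)) j C : R :=
  if j is i.+1 then
    weight mu Jt J i (parent Jt J i C) / children_mass mu Jt J i (parent Jt J i C) *
    fine (mu C)
  else 1.
Local Notation w := (weight mu Jt J).

Let w_child j D C : Jt j D -> ch j D C -> w j.+1 C = w j D / cm j D * m C.
Proof.
move=> JD hC; suff <- : parent Jt J j C = D by [].
have [JP hP] : Jt j (parent Jt J j C) /\ ch j (parent Jt J j C) C.
  by apply: (@xgetPex _ set0 [set D | Jt j D /\ ch j D C]); exists D.
exact: children_inj pat _ _ _ _ JP JD hP hC.
Qed.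

Let w_ge0 j C : 0 <= w j C.
Proof.
elim: j C => //= j IH C; rewrite mulr_ge0 ?fine_ge0// divr_ge0//.
by rewrite fine_ge0// esum_ge0.
Qed.

Let w_children j D (K : set (set S)) : Jt j D -> K `<=` ch j D ->
  (\esum_(C in K) (w j.+1 C)%:E = (w j D / cm j D)%:E * \esum_(C in K) mu C)%E.
Proof.
move=> JD Kch; have cm0 := cm_gt0 _ _ JD.
(* [esum_pZl] wants a positive factor, so zero weight is treated apart. *)
have [w0|w0] := eqVneq (w j D) 0.
  rewrite w0 mul0r mul0e esum1// => C /Kch hC.
  by rewrite (w_child _ _ _ JD hC) w0 !mul0r.
rewrite -esum_pZl//; last by rewrite divr_gt0// lt_def w0 w_ge0.
apply: eq_esum => C /Kch hC; rewrite (w_child _ _ _ JD hC) EFinM.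
by rewrite (cyl_fineK _ _ (pattern_Jt_cyl pat hC.1)).
Qed.

Let w_sum j D : Jt j D -> ((w j D)%:E <= \esum_(C in ch j D) (w j.+1 C)%:E)%E.
Proof.
move=> JD; rewrite (w_children _ _ _ JD)// cmE// -EFinM lee_fin divfK//.
by rewrite gt_eqF// cm_gt0.
Qed.

Local Notation sa j := (\sum_(1 <= k < j.+1) alpha k + \sum_(1 <= k < j.+1) gamma k).
Local Notation sb j := (\sum_(1 <= k < j.+1) beta k).
Local Notation pd j := (\prod_(1 <= k < j.+1) delta k).

Lemma prod_delta_gt0 j : 0 < pd j.
Proof.
rewrite big_nat; elim/big_ind : _ => //; first exact: mulr_gt0.
by move=> k /andP[k0 _]; have [] := pos k k0.
Qed.

Let w_le j D : Jt j D -> w j D * pd j <= expR (- sb j).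
Proof.
elim: j D => [|j IH] C JC; first by rewrite /= !big_geq// oppr0 expR0 mulr1.
have [D JD hC] := Jt_parent pat _ _ JC.
rewrite (w_child _ _ _ JD hC). rewrite !(big_nat_recr j.+1)//= opprD expRD.
have [_ mCb _] := child_ratio _ _ _ JD hC.
have /andP[lo _] := cm_bounds _ _ JD.
have cm0 := cm_gt0 _ _ JD.
have [_ _ _ d0] := pos j.+1 isT.
(* The last factor is at most exp(-beta), because cm j D >= delta j.+1 * m (cr j D). *)
rewrite (_ : _ * _ = w j D * pd j * (m C * delta j.+1 / cm j D)); last first.
  by ring.
apply: ler_pM; last 2 first.
- exact: IH.
- rewrite ler_pdivrMr// (le_trans (ler_wpM2r (ltW d0) mCb))//.
  by rewrite -mulrA ler_wpM2l ?expR_ge0// mulrC.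
- exact: mulr_ge0 (w_ge0 _ _) (ltW (prod_delta_gt0 _)).
- by rewrite divr_ge0 ?(ltW cm0)// mulr_ge0 ?(ltW d0)// ltW// (Jt_gt0 _ _ JC).
Qed.

(** [alpha] and [beta] bound the same ratio, so beta <= alpha. With [prod_delta_le1] this will force
    s <= 1. *)
Lemma sum_beta_le j : sb j <= sa j.
Proof.
rewrite -big_split /= !big_nat ler_sum// => -[//|k] _.
have [D JD] := Jt_inhabited k; have [C hC] := has_child _ _ JD.
have [lo hi _] := child_ratio _ _ _ JD hC.
have [_ _ g0 _] := pos k.+1 isT.
have := le_trans lo hi; rewrite ler_pM2r ?core_gt0// ler_expR lerN2 => ba.
by rewrite (le_trans ba)// lerDl ltW.
Qed.

Lemma prod_delta_le1 j : pd j <= 1.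
Proof.
rewrite big_nat prodr_ile1// => -[//|k] _; have [D JD] := Jt_inhabited k.
by have [_ _ _ /ltW ->] := pos k.+1 isT; rewrite (delta_le1 _ _ JD).
Qed.

(** * Comparing mass with powers of the measure *)

Variable J0 : set S.
Hypothesis JtJ0 : Jt 0%N J0.

(** Passing to a child loses at most exp(-alpha), and to its core at most exp(-gamma); the root is
    its own core. *)
Let core_ge j D : Jt j D -> expR (- sa j) * m J0 <= m (cr j D).
Proof.
elim: j D => [|j IH] C JC.
  have [E0 [JtE JE]] := pattern_root pat.
  move: (JtJ0) (JC); rewrite JtE => -> ->.
  rewrite !big_geq// addr0 oppr0 expR0 mul1r (core_eq pat _ _ E0) ?JtE ?JE//.
have [D JD hC] := Jt_parent pat _ _ JC.
have [mCa _ mcg] := child_ratio _ _ _ JD hC.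
rewrite !(big_nat_recr j.+1)//= addrACA opprD (opprD (alpha _)) !expRD.
apply: le_trans mcg; rewrite (_ : _ * m J0 =
    expR (- gamma j.+1) * (expR (- alpha j.+1) * (expR (- sa j) * m J0))); last by ring.
rewrite ler_wpM2l ?expR_ge0// (le_trans _ mCa)// ler_wpM2l ?expR_ge0//.
exact: IH.
Qed.

Let J0_gt0 : 0 < m J0 := Jt_gt0 _ _ JtJ0.

Variables (s : R) (j0 : nat).
Hypotheses (s0 : 0 <= s) (s1 : s <= 1).
(** Exponential form of s * sa j <= sb j + ln (pd j.+1), that is, of [s] not exceeding the quotient
    at level [j]. *)
Hypothesis key : forall j, (j0 <= j)%N ->
  expR (- sb j) <= expR (- (s * sa j)) * pd j.+1.

(** [key] has one more delta than [w_le]; the spare [delta j.+1] is kept to offset the lower bound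
    on [cm j D]. *)
Let w_bound j D : (j0 <= j)%N -> Jt j D ->
  w j D <= delta j.+1 * (m (cr j D) / m J0) `^ s.
Proof.
move=> j0j JD; have [_ _ _ d0] := pos j.+1 isT.
rewrite -(ler_pM2r (prod_delta_gt0 j)).
apply: le_trans (w_le _ _ JD) _; apply: le_trans (key _ j0j) _.
rewrite (big_nat_recr j.+1)//= (mulrC (delta _)) -mulrA (mulrC (delta _)).
rewrite ler_pM2r ?mulr_gt0 ?prod_delta_gt0// mulrC -mulNr expRM.
apply: ge0_ler_powR; rewrite ?nnegrE ?expR_ge0 ?divr_ge0 ?fine_ge0//.
by rewrite ler_pdivlMr// core_ge.
Qed.

(** Trades a covering cylinder for nodes of a single level, one past a level where a core still
    contains [F]. *)
Lemma cylinder_cover n F : is_ncylinder n F -> F `&` pattern_set J !=set0 ->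
  diam F < 2 ^- d j0 ->
  exists g : nat * set (set S), [/\ g.2 `<=` Jt g.1,
    F `&` pattern_set J `<=` \bigcup_(C in g.2) C &
    (\esum_(C in g.2) (w g.1 C)%:E <= ((m F / m J0) `^ s)%:E)%E].
Proof.
move=> hF [z [Fz Zz]] dF.
pose P j := exists2 D, Jt j D & F `<=` cr j D.
have P0 : P j0.
  have [D JD Dz] := mem_patternP pat _ Zz j0; exists D => // y Fy.
  by apply/(ncylinderP _ _ _ (core_cyl _ _ JD) Dz); exact: diam_agree dF _ _ Fz Fy.
(* Such a level exists: [F] has two distinct points, and deep cores would force them to agree at the
   letter where they differ. *)
have [j j0j [Pj nPj]] : exists2 j, (j0 <= j)%N & P j /\ ~ P j.+1.
  apply: contrapT => noj.
  have Pk k : P (j0 + k)%N.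
    elim: k => [|k IH]; first by rewrite addn0.
    apply: contrapT => nP; apply: noj; exists (j0 + k)%N; first exact: leq_addr.
    by rewrite -addnS.
  have [x [y [Fx Fy]]] := gibbs_cylinder_two _ _ gib atl hF.
  case: (shift_dist_spec x y) => [[k xyk _]|[//]].
  have [D JD FD] := Pk k.
  have := (ncylinderP _ _ _ (core_cyl _ _ JD) (FD _ Fx) y).1 (FD _ Fy) k.
  move=> yx; move: xyk; rewrite yx ?eqxx//.
  by apply: leq_trans (depth_ge pat (j0 + k)).1; exact: leq_addl.
have [D JD FD] := Pj.
have [C JC cCz] := mem_patternP pat _ Zz j.+1.
have Cz : C z := (coreP pat _ _ JC).2 _ cCz.
(* No core of level [j.+1] contains [F], so the one through [z] lies inside it. *)
have cCF : cr j.+1 C `<=` F.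
  have [FC|//] := ncylinder_nested hF (core_cyl _ _ JC) Fz cCz.
  by case: nPj; exists C.
have mF0 : 0 < m F := gibbs_cylinder_gt0 _ _ gib hF.
(* If [F] lies in [C], the single node [C] is enough: its core lies in [F], and delta <= 1. *)
have [FC|CF] := ncylinder_nested hF (pattern_Jt_cyl pat JC) Fz Cz.
  exists (j.+1, [set C]); split => /=;
    [by move=> _ ->|by move=> y [/FC Cy _]; exists C|].
  rewrite esum_set1 lee_fin; last exact: (w_ge0 j.+1).
  apply: (le_trans (w_bound _ _ (leqW j0j) JC)).
  apply: (@le_trans _ _ ((m (cr j.+1 C) / m J0) `^ s)).
    by rewrite ler_piMl ?powR_ge0// (delta_le1 _ _ JC).
  apply: ge0_ler_powR; rewrite ?nnegrE ?divr_ge0 ?fine_ge0//.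
  by rewrite ler_pM2r ?invr_gt0// (m_le _ _ _ _ (core_cyl _ _ JC) hF).
(* Now [C] lies in [F]. A node of this level meeting [F] lies in [F] too: if it contained [F] it
   would contain [z] and be [C]. *)
pose K := [set C' : set S | Jt j.+1 C' /\ C' `<=` F].
exists (j.+1, K); split => /=; first by move=> C' [].
  move=> y [Fy Zy].
  have [C' JC' /(coreP pat _ _ JC').2 C'y] := mem_patternP pat _ Zy j.+1.
  exists C' => //; split => //.
  have [FC'|//] := ncylinder_nested hF (pattern_Jt_cyl pat JC') Fy C'y.
  by rewrite (Jt_eq pat _ _ _ _ JC' JC (FC' _ Fz) Cz).
have [_ _ _ d0] := pos j.+1 isT.
have cD0 := core_gt0 _ _ JD; have cm0 := cm_gt0 _ _ JD.
rewrite (w_children _ _ _ JD); last first.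
  by move=> C' [JC' C'F]; split=> //; exact: subset_trans FD.
apply: (@le_trans _ _ ((w j D / cm j D)%:E * (m F)%:E)%E).
  rewrite lee_wpmul2l ?lee_fin ?divr_ge0 ?w_ge0 ?(ltW cm0)//.
  by apply: (sub_mass _ _ j.+1 _ hF) => C' [].
rewrite -EFinM lee_fin.
have /andP[lo _] := cm_bounds _ _ JD.
have mFD : m F / m (cr j D) <= 1.
  by rewrite ler_pdivrMr// mul1r (m_le _ _ _ _ hF (core_cyl _ _ JD)).
(* The [delta j.+1] of [w_bound] cancels against the one in the lower bound for [cm j D]. *)
apply: (@le_trans _ _ ((m (cr j D) / m J0) `^ s * (m F / m (cr j D)))).
  rewrite [leRHS]mulrCA [leRHS]mulrC ler_wpM2r ?(ltW mF0)//.
  rewrite ler_pdivrMr// (le_trans (w_bound _ _ j0j JD))//.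
  by rewrite mulrC -mulrA ler_wpM2l ?powR_ge0// mulrC ler_pdivlMr.
(* Here t <= t^s, as 0 < t <= 1 and s <= 1. *)
apply: (@le_trans _ _ ((m (cr j D) / m J0) `^ s * (m F / m (cr j D)) `^ s)).
  rewrite ler_wpM2l ?powR_ge0// -[leLHS]powRr1 ?divr_ge0 ?(ltW mF0) ?(ltW cD0)//.
  by apply: ger_powR; rewrite // divr_gt0.
rewrite -powRM ?divr_ge0 ?(ltW mF0) ?(ltW cD0) ?(ltW J0_gt0)//.
by rewrite mulrC mulrA divfK ?gt_eqF.
Qed.

(** Replacing each member of the cover by its nodes gives a cover by nodes, which weighs at least
    the root weight 1. *)
Lemma premeasure_ge eps : eps < 2 ^- d j0 ->
  ((m J0 `^ s)%:E <= M_premeasure mu s eps (pattern_set J))%E.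
Proof.
move=> epsj0; apply: le_ereal_inf_tmp => _ [[D F] /= [cF cov] <-].
pose D' := [set i | D i /\ F i `&` pattern_set J !=set0].
have exg i : exists gi : nat * set (set S), D' i -> [/\ gi.2 `<=` Jt gi.1,
    F i `&` pattern_set J `<=` \bigcup_(C in gi.2) C &
    (\esum_(C in gi.2) (w gi.1 C)%:E <= ((m (F i) / m J0) `^ s)%:E)%E].
  have [[Di FZ]|nD] := pselect (D' i); last by exists (0%N, set0).
  have [[n hF] dF] := cF _ Di.
  have [gi gP] := cylinder_cover _ _ hF FZ (le_lt_trans dF epsj0).
  by exists gi.
have [g gP] := choice exg.
have J0s : 0 < m J0 `^ s by rewrite powR_gt0.
(* Indexing by pairs counts a node once for each member that uses it. *)
pose L := D' `*`` (fun i => (g i).2).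
have := @cover_cost_ge _ _ _ _ _ _ _ pat _ w_ge0 w_sum _ L
  (fun x => (g x.1).1) snd _ _ JtJ0.
rewrite /= -(@esum_esum _ _ _ _ _ (fun i C => (w (g i).1 C)%:E)); last first.
  by move=> *; rewrite lee_fin.
move=> /(_ _ _)/wrap[].
- by move=> [i C] [/= /gP[+ _ _]]; exact.
- move=> z Zz; have [i Di Fiz] := cov _ Zz.
  have D'i : D' i by split => //; exists z.
  have [_ /(_ z (conj Fiz Zz))[C gC Cz] _] := gP _ D'i.
  by exists (i, C).
move=> le1.
have : (1 <= (m J0 `^ s)^-1%:E * \esum_(i in D) (mu (F i) `^ s))%E.
  rewrite -esum_pZl ?invr_gt0//; last by move=> i; rewrite poweR_ge0.
  apply: (le_trans le1); apply: (@le_trans _ _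
    (\esum_(i in D') ((m J0 `^ s)^-1%:E * (mu (F i) `^ s)))%E).
    apply: le_esum => i D'i; have [_ _] := gP _ D'i; move/le_trans; apply.
    have [[n hF] _] := cF _ D'i.1.
    rewrite (cyl_fineK _ _ hF) poweR_EFin -EFinM lee_fin [leRHS]mulrC.
    rewrite powRM ?fine_ge0// ?invr_ge0 ?(ltW J0_gt0)//.
    by rewrite -[(m J0)^-1]powR_inv1 ?(ltW J0_gt0)// -powRrM mulN1r powRN.
  by apply: esum_subset => i [].
by rewrite muleC lee_pdivlMr// mul1e.
Qed.

End mass.

(** * Lower limits and the limit of the premeasures *)

Lemma limn_einf_gt {R : realType} (u : (\bar R)^nat) (x : \bar R) :
  (x < limn_einf u)%E -> exists n, forall k, (n <= k)%N -> (x < u k)%E.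
Proof.
rewrite limn_einf_lim (cvg_lim _ (@cvg_einfs_sup R u))//.
move=> /ereal_sup_gt[_ [n _ <-] xn].
by exists n => k nk; apply: lt_le_trans xn _; apply: ereal_inf_lbound; exists k.
Qed.

(** A larger eps admits more covers, so the premeasure is nonincreasing in eps and its right limit
    at 0 exists. *)
Lemma M_measure_ge {R : realType} {I : countType} {A : rel I} (x0 : Sigma R A)
    (mu : probability (BorelSigma x0) R) (s r : R) (c : \bar R)
    (E : set (Sigma R A)) : 0 < r ->
  (forall eps, eps < r -> (c <= M_premeasure mu s eps E)%E) ->
  (c <= M_measure mu s E)%E.
Proof.
move=> r0 cM; apply: lime_ge; last first.
  by near=> eps; apply: cM; near: eps; exact: nbhs_right_lt.
apply: nonincreasing_at_right_is_cvge; near=> b => x y _ _ xy.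
apply: ereal_inf_le_tmp => _ [c' [cF cov] <-]; exists c' => //; split => // i /cF[? dF].
by split => //; exact: le_trans xy.
Unshelve. all: by end_near. Qed.

(** * From the lower limit to the dimension *)

Theorem corollary4p2 (R : realType) (I : countType) (A : rel I)
  (x0 : Sigma R A) (mu : probability (BorelSigma x0) R) (phi : Sigma R A -> R)
  (dt d : nat -> nat) (Jt J : nat -> set (set (Sigma R A)))
  (alpha beta gamma delta : nat -> R) :
  topologically_mixing R A ->
  is_gibbs mu phi ->
  atomless mu ->
  is_pattern dt d Jt J ->
  (forall j, (0 < j)%N ->
     [/\ 0 < alpha j, 0 < beta j, 0 < gamma j & 0 < delta j]) ->
  (forall j, (0 < j)%N -> forall Jj Jtj Jp : set (Sigma R A),
     J j Jj -> Jt j Jtj -> J j.-1 Jp -> Jj `<=` Jtj -> Jtj `<=` Jp ->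
     expR (- alpha j) <= fine (mu Jtj) / fine (mu Jp) <= expR (- beta j) /\
     expR (- gamma j) <= fine (mu Jj) / fine (mu Jtj)) ->
  (forall j, (0 < j)%N -> forall Jp : set (Sigma R A), J j.-1 Jp ->
     ((delta j)%:E * mu Jp <=
      \esum_(C in [set C | Jt j C /\ C `<=` Jp]) mu C)%E) ->
  (exists eta : R, 1 < eta /\
     (0 < limn_einf (fun j : nat =>
       ((\sum_(1 <= k < j.+1) alpha k + \sum_(1 <= k < j.+1) gamma k) /
        j%:R `^ eta)%:E))%E) ->
  (limn_einf (fun j : nat =>
     ((\sum_(1 <= k < j.+1) beta k - ln (1 / \prod_(1 <= k < j.+2) delta k)) /
      (\sum_(1 <= k < j.+1) alpha k + \sum_(1 <= k < j.+1) gamma k))%:E)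
   <= Dim mu (pattern_set J))%E.
Proof.
move=> _ gib atl pat pos ratio dens _.
apply: le_ereal_inf_tmp => _ [s [s0 Ms] <-]; rewrite leNgt; apply/negP.
move=> /limn_einf_gt[j1 gt_s].
have [J0 [JtJ0 _]] := pattern_root pat.
have JJ0 : Jt 0%N J0 by rewrite JtJ0.
pose sa j := \sum_(1 <= k < j.+1) alpha k + \sum_(1 <= k < j.+1) gamma k.
pose sb j := \sum_(1 <= k < j.+1) beta k.
pose pd j := \prod_(1 <= k < j.+1) delta k.
have pd0 j : 0 < pd j := prod_delta_gt0 pos j.
have sa0 j : 0 < sa j.+1.
  rewrite /sa !(big_nat_recr j.+1)//= addrACA ltr_wpDl ?addr_gt0//; last 2 first.
  - by have [] := pos j.+1 isT.
  - by have [] := pos j.+1 isT.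
  by rewrite addr_ge0// big_nat sumr_ge0// => k /andP[k0 _];
    have [/ltW ? _ /ltW ? _] := pos k k0.
(* Starting at [j1.+1] keeps [j] positive: [sa 0] is 0 and cannot be divided by. *)
have ssa j : (j1.+1 <= j)%N -> s * sa j < sb j + ln (pd j.+1).
  case: j => // j j1j; have := gt_s j.+1 (ltnW j1j).
  by rewrite lte_fin ltr_pdivlMr ?sa0// div1r lnV ?posrE ?pd0// opprK.
(* At level [j1.+1]: s * sa <= sb + ln pd <= sb <= sa, and sa > 0. *)
have s1 : s <= 1.
  rewrite -(ler_pM2r (sa0 j1)) mul1r (le_trans (ltW (ssa _ (leqnn _))))//.
  rewrite (le_trans _ (sum_beta_le gib pat pos ratio dens j1.+1))//.
  by rewrite gerDl ln_le0// (prod_delta_le1 gib pat pos dens).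
have key j : (j1.+1 <= j)%N -> expR (- sb j) <= expR (- (s * sa j)) * pd j.+1.
  move=> /ssa/ltW sle; have -> : pd j.+1 = expR (ln (pd j.+1)) by rewrite lnK ?posrE.
  by rewrite -expRD ler_expR lerNl opprD opprK lerBlDr.
have mJ0 : 0 < fine (mu J0) `^ s.
  by rewrite powR_gt0// (gibbs_cylinder_gt0 _ _ gib (pattern_Jt_cyl pat JJ0)).
have : ((fine (mu J0) `^ s)%:E <= M_measure mu s (pattern_set J))%E.
  apply: (@M_measure_ge _ _ _ _ _ _ (2 ^- d j1.+1)).
    by rewrite invr_gt0 exprn_gt0.
  by move=> eps; exact: (premeasure_ge gib atl pat pos ratio dens _ JJ0 _ _ s0 s1 key).
by rewrite Ms lee_fin leNgt mJ0.
Qed.
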